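(* Let $\zeta=e^{2\pi i/13}$, $\sqrt{13}>0$, and let $S$, $T\in GL(6,\mathbb{C})$ be $$S=-\frac{1}{\sqrt{13}}\begin{pmatrix} \zeta^{12}-\zeta & \zeta^{10}-\zeta^3 & \zeta^4-\zeta^9 & \zeta^5-\zeta^8 & \zeta^2-\zeta^{11} & \zeta^6-\zeta^7\\ \zeta^{10}-\zeta^3 & \zeta^4-\zeta^9 & \zeta^{12}-\zeta & \zeta^2-\zeta^{11} & \zeta^6-\zeta^7 & \zeta^5-\zeta^8\\ \zeta^4-\zeta^9 & \zeta^{12}-\zeta & \zeta^{10}-\zeta^3 & \zeta^6-\zeta^7 & \zeta^5-\zeta^8 & \zeta^2-\zeta^{11}\\ \zeta^5-\zeta^8 & \zeta^2-\zeta^{11} & \zeta^6-\zeta^7 & \zeta-\zeta^{12} & \zeta^3-\zeta^{10} & \zeta^9-\zeta^4\\ \zeta^2-\zeta^{11} & \zeta^6-\zeta^7 & \zeta^5-\zeta^8 & \zeta^3-\zeta^{10} & \zeta^9-\zeta^4 & \zeta-\zeta^{12}\\ \zeta^6-\zeta^7 & \zeta^5-\zeta^8 & \zeta^2-\zeta^{11} & \zeta^9-\zeta^4 & \zeta-\zeta^{12} & \zeta^3-\zeta^{10} \end{pmatrix},\qquad T=\mathrm{diag}(\zeta^7,\zeta^{11},\zeta^8,\zeta^6,\zeta^2,\zeta^5).$$ Let $G$ be the subgroup of $PGL(6,\mathbb{C})$ generated by the images of $S$ and $T$. Put $P=ST^{-1}S$, $Q=ST^3$, $x_3=QP^2$ and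 $y_3=Q^5P^2$. Then the images of $x_3$ and $y_3$ in $PGL(6,\mathbb{C})$ generate $G$.
   Context: Matrices in $GL(6,\mathbb{C})$ are regarded as projective transformations of $\mathbb{P}^5$, i.e. via their images in $PGL(6,\mathbb{C})$. *)

(* Defs.v *)
From HB Require Import structures.
From mathcomp Require Import all_boot all_order all_algebra generic_quotient.
From mathcomp Require Import boolp classical_sets reals trigo.
From mathcomp Require Import complex ring.

Set Implicit Arguments.
Unset Strict Implicit.
Unset Printing Implicit Defensive.

Import Order.TTheory GRing.Theory Num.Theory.

Local Open Scope ring_scope.
Local Open Scope quotient_scope.

(* The library's {'GL_n[R]} requires a finite ring R, so the general linear    *)
(* group over an arbitrary field is built here as the subtype of unitmx.      *)
Record GL (n : nat) (F : fieldType) :=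
  MkGL { GLmx :> 'M[F]_n ; _ : GLmx \in unitmx }.

HB.instance Definition _ n F := [isSub for @GLmx n F].
HB.instance Definition _ n F := [Choice of GL n F by <:].

Section GLGroup.
Variables (n : nat) (F : fieldType).
Implicit Types A B C : GL n F.

Lemma GL_unitmx A : (A : 'M_n) \in unitmx. Proof. exact: valP. Qed.

Lemma GL_mul_subproof A B : (A : 'M_n) *m B \in unitmx.
Proof. by rewrite unitmx_mul !GL_unitmx. Qed.

Lemma GL_inv_subproof A : invmx A \in unitmx.
Proof. by rewrite unitmx_inv GL_unitmx. Qed.

Definition GL_one : GL n F := MkGL (@unitmx1 F n).
Definition GL_mul A B : GL n F := MkGL (GL_mul_subproof A B).
Definition GL_inv A : GL n F := MkGL (GL_inv_subproof A).

Lemma GL_mulA : associative GL_mul.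
Proof. by move=> A B C; apply: val_inj; rewrite /= mulmxA. Qed.

Lemma GL_mul1 : left_id GL_one GL_mul.
Proof. by move=> A; apply: val_inj; rewrite /= mul1mx. Qed.

Lemma GL_mulr1 : right_id GL_one GL_mul.
Proof. by move=> A; apply: val_inj; rewrite /= mulmx1. Qed.

Lemma GL_mulV : left_inverse GL_one GL_inv GL_mul.
Proof. by move=> A; apply: val_inj; rewrite /= mulVmx ?GL_unitmx. Qed.

Lemma GL_mulrV : right_inverse GL_one GL_inv GL_mul.
Proof. by move=> A; apply: val_inj; rewrite /= mulmxV ?GL_unitmx. Qed.

HB.instance Definition _ := isGroup.Build (GL n F)
  GL_mulA GL_mul1 GL_mulr1 GL_mulV GL_mulrV.

End GLGroup.

Section PGL.
Variables (n : nat) (F : fieldType).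
Implicit Types A B : GL n F.

Definition proj_eq A B : bool :=
  `[< exists2 c : F, c != 0 & (A : 'M_n) = c *: (B : 'M_n) >].

Lemma proj_eqP A B :
  reflect (exists2 c : F, c != 0 & (A : 'M_n) = c *: (B : 'M_n)) (proj_eq A B).
Proof. exact: asboolP. Qed.

Lemma proj_eq_refl : reflexive proj_eq.
Proof. by move=> A; apply/proj_eqP; exists 1; rewrite ?oner_eq0 ?scale1r. Qed.

Lemma proj_eq_sym : symmetric proj_eq.
Proof.
suff sub A B : proj_eq A B -> proj_eq B A.
  by move=> A B; apply/idP/idP; apply: sub.
move=> /proj_eqP[c c0 cE]; apply/proj_eqP.
exists c^-1; first by rewrite invr_eq0.
by rewrite cE scalerA mulVf // scale1r.
Qed.

Lemma proj_eq_trans : transitive proj_eq.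
Proof.
move=> B A C /proj_eqP[c c0 cE] /proj_eqP[d d0 dE].
apply/proj_eqP; exists (c * d); first by rewrite mulf_neq0.
by rewrite cE dE scalerA.
Qed.

Canonical proj_eq_equiv :=
  EquivRel proj_eq proj_eq_refl proj_eq_sym proj_eq_trans.

Definition PGL := {eq_quot proj_eq}.

HB.instance Definition _ := Choice.on PGL.
HB.instance Definition _ := EqQuotient.on PGL.

Definition toPGL A : PGL := \pi_PGL A.

Lemma toPGL_eqP A B :
  toPGL A = toPGL B <-> exists2 c : F, c != 0 & (A : 'M_n) = c *: (B : 'M_n).
Proof.
by split=> [/eqmodP/proj_eqP | /proj_eqP AB] //; apply/eqmodP.
Qed.

Lemma toPGL_repr (x : PGL) : toPGL (repr x) = x. Proof. exact: reprK. Qed.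

Definition PGL_one : PGL := toPGL 1%g.
Definition PGL_mul (x y : PGL) : PGL := toPGL (repr x * repr y)%g.
Definition PGL_inv (x : PGL) : PGL := toPGL (repr x)^-1%g.

Lemma toPGL_mul A B : toPGL (A * B)%g = PGL_mul (toPGL A) (toPGL B).
Proof.
have /toPGL_eqP[c c0 cE] := toPGL_repr (toPGL A).
have /toPGL_eqP[d d0 dE] := toPGL_repr (toPGL B).
apply/esym/toPGL_eqP; exists (c * d); first by rewrite mulf_neq0.
by rewrite [LHS]/= cE dE -scalemxAl -scalemxAr scalerA.
Qed.

Lemma toPGL_inv A : toPGL A^-1%g = PGL_inv (toPGL A).
Proof.
have /toPGL_eqP[c c0 cE] := toPGL_repr (toPGL A).
apply/esym/toPGL_eqP; exists c^-1; first by rewrite invr_eq0.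
by rewrite [LHS]/= cE invmxZ // unitmxZ ?GL_unitmx ?unitfE.
Qed.

Lemma PGL_mulA : associative PGL_mul.
Proof.
elim/quotW=> A; elim/quotW=> B; elim/quotW=> C; rewrite -!/(toPGL _).
by rewrite -!toPGL_mul mulgA.
Qed.

Lemma PGL_mul1 : left_id PGL_one PGL_mul.
Proof. by elim/quotW=> A; rewrite -/(toPGL _) -toPGL_mul mul1g. Qed.

Lemma PGL_mulr1 : right_id PGL_one PGL_mul.
Proof. by elim/quotW=> A; rewrite -/(toPGL _) -toPGL_mul mulg1. Qed.

Lemma PGL_mulV : left_inverse PGL_one PGL_inv PGL_mul.
Proof. by elim/quotW=> A; rewrite -/(toPGL _) -toPGL_inv -toPGL_mul mulVg. Qed.

Lemma PGL_mulrV : right_inverse PGL_one PGL_inv PGL_mul.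
Proof. by elim/quotW=> A; rewrite -/(toPGL _) -toPGL_inv -toPGL_mul mulgV. Qed.

HB.instance Definition _ := isGroup.Build PGL
  PGL_mulA PGL_mul1 PGL_mulr1 PGL_mulV PGL_mulrV.

Lemma toPGLM : {morph toPGL : A B / (A * B)%g >-> (A * B)%g}.
Proof. exact: toPGL_mul. Qed.

Lemma toPGLV : {morph toPGL : A / A^-1%g >-> A^-1%g}.
Proof. exact: toPGL_inv. Qed.

End PGL.

(* The intersection of all subgroups of gT containing A. *)
Definition generated (gT : groupType) (A : set gT) : set gT :=
  smallest (fun H : set gT => group_closed [in H]) A.

Definition mx_of_rows (F : fieldType) m n (s : seq (seq F)) : 'M[F]_(m, n) :=
  \matrix_(i < m, j < n) (nth [::] s i)`_j.

Section Generators.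
Variable R : realType.

Definition zeta : R[i] := (cos (2 * pi / 13) +i* sin (2 * pi / 13))%C.

Local Notation z := zeta.

Definition Smx : 'M[R[i]]_6 := - ((Num.sqrt 13)%:C)%C^-1 *: mx_of_rows 6 6
  [:: [:: z^+12 - z;     z^+10 - z^+3;  z^+4 - z^+9;
          z^+5 - z^+8;   z^+2 - z^+11;  z^+6 - z^+7];
      [:: z^+10 - z^+3;  z^+4 - z^+9;   z^+12 - z;
          z^+2 - z^+11;  z^+6 - z^+7;   z^+5 - z^+8];
      [:: z^+4 - z^+9;   z^+12 - z;     z^+10 - z^+3;
          z^+6 - z^+7;   z^+5 - z^+8;   z^+2 - z^+11];
      [:: z^+5 - z^+8;   z^+2 - z^+11;  z^+6 - z^+7;
          z - z^+12;     z^+3 - z^+10;  z^+9 - z^+4];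
      [:: z^+2 - z^+11;  z^+6 - z^+7;   z^+5 - z^+8;
          z^+3 - z^+10;  z^+9 - z^+4;   z - z^+12];
      [:: z^+6 - z^+7;   z^+5 - z^+8;   z^+2 - z^+11;
          z^+9 - z^+4;   z - z^+12;     z^+3 - z^+10]].

Definition Tmx : 'M[R[i]]_6 :=
  diag_mx (\row_(i < 6) [:: z^+7; z^+11; z^+8; z^+6; z^+2; z^+5]`_i).

Lemma zetaX n : z ^+ n =
  (cos (n%:R * (2 * pi / 13)) +i* sin (n%:R * (2 * pi / 13)))%C.
Proof.
rewrite /zeta; move: (2 * pi / 13) => t.
elim: n => [|n IHn]; first by rewrite mul0r cos0 sin0.
rewrite exprS IHn -(nat1r n) mulrDl mul1r cosD sinD.
by apply/eqP; rewrite eq_complex /= eqxx /= addrC.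
Qed.

Lemma zeta13 : z ^+ 13 = 1.
Proof.
rewrite zetaX mulrC divfK ?pnatr_eq0 //.
by rewrite mulr_natl cos2pi sin2pi.
Qed.

Lemma zeta_neq1 : z != 1.
Proof.
have sin_gt0 : 0 < sin (2 * pi / 13) :> R.
  apply: sin_gt0_pi; have pi0 := pi_gt0 R.
  rewrite divr_gt0 ?mulr_gt0 //= ltr_pdivrMr // mulrC ltr_pM2l //.
  by rewrite ltr_nat.
by apply/eqP=> -[_ /eqP]; rewrite gt_eqF.
Qed.

Lemma zeta_sum : z^+12 = - (\sum_(i < 12) z^+i).
Proof.
apply/eqP; rewrite -addr_eq0 addrC.
have := subrX1 z 13; rewrite zeta13 subrr big_ord_recr /= => /esym/eqP.
by rewrite mulf_eq0 subr_eq0 (negPf zeta_neq1).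
Qed.

(* Only needed to see Smx as an element of GL. *)
Lemma Smx2 : Smx *m Smx = - 1%:M.
Proof.
have h12 := zeta_sum.
rewrite !big_ord_recr big_ord0 /= add0r in h12.
rewrite /Smx -scalemxAl -scalemxAr scalerA mulrNN -invfM.
rewrite -[X in X^-1]rmorphM /= -expr2 sqr_sqrtr ?ler0n //.
set M := mx_of_rows _ _ _.
suff -> : M *m M = (- 13)%:M.
  rewrite rmorph_nat -mul_scalar_mx -scalar_mxM mulrN mulVf ?pnatr_eq0 //.
  by rewrite raddfN.
apply/matrixP => i j; rewrite !mxE !big_ord_recr big_ord0 /= add0r !mxE /=.
move: z h12 => z h12.
case: i => -[|[|[|[|[|[|//]]]]]] i6; case: j => -[|[|[|[|[|[|//]]]]]] j6 /=;
  ring: h12.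
Qed.

Lemma Smx_unit : Smx \in unitmx.
Proof.
have : Smx *m (- Smx) = 1%:M by rewrite mulmxN Smx2 opprK.
by case/mulmx1_unit.
Qed.

Lemma Tmx_unit : Tmx \in unitmx.
Proof.
have z0 : z != 0.
  by apply/eqP=> z0; have /eqP := zeta13; rewrite z0 expr0n eq_sym oner_eq0.
rewrite unitmxE det_diag unitfE; apply/prodf_neq0 => i _; rewrite mxE.
by case: i => -[|[|[|[|[|[|]]]]]] //= _; rewrite expf_neq0.
Qed.

Definition Sgl : GL 6 R[i] := MkGL Smx_unit.
Definition Tgl : GL 6 R[i] := MkGL Tmx_unit.

End Generators.

(* Main.v *)
Require Import Defs.
From mathcomp Require Import all_boot all_order all_algebra.
From mathcomp Require Import boolp classical_sets reals complex ring.

(* With [p] and [q] the images of [P] and [Q], [y3 x3^-1] is [q ^ 4]; as [q] has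
   order 7, the subgroup generated by [x3] and [y3] contains [q], hence [p ^ 2],
   hence [p], which is conjugate to [T^-1] and has order 13. Finally
   [p ^ -3 = S T^3 S = q S] in PGL, so [S], and then [T], are recovered.

   That [q ^ 7 = 1] comes from the Weil representation of SL_2(F_13) on odd
   functions: up to scalars, [S] and [S T^3] are matrices with entries
   [z^(a u^2 + c v^2) (z^(- b u v) - z^(b u v))], where [u] and [v] run over
   representatives of [F_13^* / {1, -1}]. Completing the square in a Gauss sum
   shows that, up to a scalar, products of such matrices have the same form. *)

(** * Gauss sums and Weil kernels over [F_13] *)

Section WeilKernels.
Import GRing.Theory Num.Theory.
Local Open Scope ring_scope.
Variable R : realType.

Definition chi (x : 'F_13) : R[i] := zeta R ^+ x.

Lemma chi0 : chi 0 = 1. Proof. by []. Qed.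

Lemma chiD x y : chi (x + y) = chi x * chi y.
Proof. by rewrite /chi -exprD -[RHS](expr_mod _ (zeta13 R)). Qed.

(* Chosen so that [Smx] has entries proportional to z^(- u v) - z^(u v) and
   [Tmx] has diagonal entries z^(u^2 / 2), for [u], [v] in the range of [pt]. *)
Definition pt (i : 'I_6) : 'F_13 := [:: 1; 3; 9; 8; 11; 7]`_i.

(** The values [pt i] and [- pt i] exhaust the nonzero elements of [F_13], each occurring once. *)
Lemma sum_pt (A : 'F_13 -> R[i]) :
  \sum_u A u = A 0 + \sum_i (A (pt i) + A (- pt i)).
Proof.
have -> : \sum_u A u = \sum_(n < 13) A n%:R.
  by apply: eq_bigr => u _; rewrite natr_Zp.
have opp_nat (m n : nat) : (m + n = 13)%N -> - m%:R = n%:R :> 'F_13.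
  by move=> mn; apply/eqP; rewrite eq_sym -addr_eq0 addrC -natrD mn.
rewrite !big_ord_recr !big_ord0 /pt /=.
rewrite -[1]/(1%:R) (opp_nat 1 12)%N // (opp_nat 3 10)%N // (opp_nat 9 4)%N //.
rewrite (opp_nat 8 5)%N // (opp_nat 11 2)%N // (opp_nat 7 6)%N //.
by ring.
Qed.

Lemma sum_chi b : b != 0 -> \sum_u chi (b * u) = 0.
Proof.
move=> b0; transitivity (\sum_u chi u).
  by rewrite [RHS](reindex_inj (mulfI b0)).
by rewrite [LHS](@big_ord_recr _ _ _ 12) /= [chi ord_max]zeta_sum subrr.
Qed.

Definition gauss a : R[i] := \sum_u chi (a * u ^+ 2).

Lemma gauss_complete (a b : 'F_13) : a != 0 ->
  \sum_u chi (a * u ^+ 2 + b * u) = chi (- (b ^+ 2 / (4 * a))) * gauss a.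
Proof.
(* The shift of [u] by [- b / (2 a)] removes the linear term. *)
move=> a0; rewrite (reindex_inj (addIr (- (b / (2 * a))))) /= mulr_sumr.
apply: eq_bigr => u _; rewrite -chiD; congr chi; field.
by rewrite a0.
Qed.

(** The operator with kernel [chi (a x^2 - b x y + c y^2)] on functions on [F_13], restricted to the
    odd ones, in the basis of differences of delta functions at [pt i] and [- pt i]. *)
Definition weil a b c : 'M[R[i]]_6 := \matrix_(i, j)
  (chi (a * pt i ^+ 2 + c * pt j ^+ 2)
     * (chi (- (b * pt i * pt j)) - chi (b * pt i * pt j))).

(** The two odd factors expand into four terms: the summands of the two full sums at [u] and [- u].
    The summands at 0 cancel. *)
Lemma weil_mul_sum (a b c a' b' c' : 'F_13) i j :
  (weil a b c *m weil a' b' c') i j =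
  chi (a * pt i ^+ 2 + c' * pt j ^+ 2) *
  (\sum_u chi ((c + a') * u ^+ 2 + (b * pt i + b' * pt j) * u)
   - \sum_u chi ((c + a') * u ^+ 2 + (b * pt i - b' * pt j) * u)).
Proof.
rewrite -sumrB sum_pt !mulr0 expr0n mulr0 subrr add0r mxE mulr_sumr.
apply: eq_bigr => k _; rewrite !mxE; move: (pt i) (pt j) (pt k) => x y u.
rewrite !chiD.
have -> : chi ((c + a') * u ^+ 2) = chi (c * u ^+ 2) * chi (a' * u ^+ 2).
  by rewrite -chiD mulrDl.
have -> : chi ((c + a') * (- u) ^+ 2) = chi (c * u ^+ 2) * chi (a' * u ^+ 2).
  by rewrite sqrrN -chiD mulrDl.
have -> : chi ((b * x + b' * y) * u) = chi (b * x * u) * chi (b' * u * y).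
  by rewrite -chiD; congr chi; ring.
have -> : chi ((b * x - b' * y) * u) = chi (b * x * u) * chi (- (b' * u * y)).
  by rewrite -chiD; congr chi; ring.
have -> : chi ((b * x + b' * y) * - u)
    = chi (- (b * x * u)) * chi (- (b' * u * y)).
  by rewrite -chiD; congr chi; ring.
have -> : chi ((b * x - b' * y) * - u) = chi (- (b * x * u)) * chi (b' * u * y).
  by rewrite -chiD; congr chi; ring.
by ring.
Qed.

Lemma weilM (a b c a' b' c' : 'F_13) : let e := c + a' in e != 0 ->
  weil a b c *m weil a' b' c' =
  gauss e *: weil (a - b ^+ 2 / (4 * e)) (b * b' / (2 * e))
                  (c' - b' ^+ 2 / (4 * e)).
Proof.
move=> e e0; apply/matrixP => i j; rewrite weil_mul_sum -/e !gauss_complete //.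
rewrite !mxE; move: (pt i) (pt j) => x y.
(* Expanding [- (b x + b' y)^2 / (4 e)] and [- (b x - b' y)^2 / (4 e)] gives the same square terms
   and opposite cross terms. *)
rewrite -mulrBl [LHS]mulrA [RHS]mulrC; congr (_ * _).
rewrite !mulrBr -!chiD; congr (chi _ - chi _); field; by rewrite e0.
Qed.

Lemma pt_inj i j : pt i = pt j -> i = j.
Proof.
move=> /eqP ij; apply/eqP; move: i j ij.
by do 2![case=> -[|[|[|[|[|[|//]]]]]] ?].
Qed.

Lemma pt_addN0 i j : pt i + pt j != 0.
Proof. by case: i j => [] [|[|[|[|[|[|//]]]]]] ? [] [|[|[|[|[|[|//]]]]]] ?. Qed.

(** The case [c + a' = 0] excluded from [weilM]: the quadratic term vanishes, and orthogonality of
    characters leaves only the diagonal. *)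
Lemma weil_scalar a b c : b != 0 -> weil a b c *m weil (- c) b (- a) = (-13)%:M.
Proof.
move=> b0; apply/matrixP => i j; rewrite weil_mul_sum subrr !mxE.
under eq_bigr do rewrite mul0r add0r.
under [X in _ - X]eq_bigr do rewrite mul0r add0r.
rewrite sum_chi ?sub0r -?mulrDr ?mulf_neq0 ?pt_addN0 //.
have [<-|ij] := eqVneq i j.
  rewrite subrr mulNr subrr chi0 mul1r mulr1n; congr (- _).
  under eq_bigr do rewrite mul0r chi0.
  by rewrite sumr_const card_Fp.
rewrite sum_chi ?oppr0 ?mulr0 ?mulr0n // -mulrBr mulf_neq0 // subr_eq0.
by apply: contra ij => /eqP/pt_inj ->.
Qed.

Lemma Smx_weil : Smx R = - ((Num.sqrt 13)%:C)%C^-1 *: weil 0 1 0.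
Proof.
congr (_ *: _); apply/matrixP => i j; rewrite !mxE !mul0r add0r chi0 !mul1r.
by case: i j => [] [|[|[|[|[|[|//]]]]]] ? [] [|[|[|[|[|[|//]]]]]] ?.
Qed.

Lemma weil_diag a b c d :
  weil a b c *m diag_mx (\row_i chi (d * pt i ^+ 2)) = weil a b (c + d).
Proof.
apply/matrixP => i j; rewrite mul_mx_diag !mxE mulrAC -chiD.
by rewrite -addrA -mulrDl.
Qed.

(** Here 7 is the inverse of 2 in [F_13]. *)
Lemma Tmx_chi : Tmx R = diag_mx (\row_i chi (7 * pt i ^+ 2)).
Proof.
congr diag_mx; apply/rowP => i; rewrite !mxE.
by case: i => [] [|[|[|[|[|[|//]]]]]].
Qed.

End WeilKernels.

(** * Relations between the images of [S] and [T] in PGL *)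

Section Relations.
Import GRing.Theory.
Local Open Scope ring_scope.

Lemma toPGLX (n : nat) (F : fieldType) (A : GL n F) k :
  toPGL (A ^+ k)%g = (toPGL A ^+ k)%g.
Proof. by elim: k => // k IHk; rewrite !expgS toPGLM IHk. Qed.

Lemma toPGL_scalar (n : nat) (F : fieldType) (A : GL n.+1 F) c :
  (A : 'M_n.+1) = c%:M -> toPGL A = 1%g.
Proof.
move=> Ac; apply/toPGL_eqP; exists c; last by rewrite Ac /= scalemx1.
apply/eqP => c0; have := Defs.GL_unitmx A.
by rewrite Ac c0 unitmxE det_scalar expr0n /= unitr0.
Qed.

Variable R : realType.

Lemma toPGL_S2 : (toPGL (Sgl R) ^+ 2 = 1)%g.
Proof.
rewrite -toPGLX; apply: (@toPGL_scalar _ _ _ (-1)).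
by rewrite /= Smx2 raddfN.
Qed.

Lemma toPGL_T13 : (toPGL (Tgl R) ^+ 13 = 1)%g.
Proof.
rewrite -toPGLX; apply: (@toPGL_scalar _ _ _ 1).
have TX k : GLmx (Tgl R ^+ k)%g = diag_mx (\row_i chi R (7 *+ k * pt i ^+ 2)).
  elim: k => [|k IHk]; first by apply/matrixP=> i j; rewrite !mxE mul0r chi0.
  rewrite expgS /= IHk Tmx_chi mulmx_diag; congr diag_mx; apply/rowP=> i.
  by rewrite !mxE -chiD -mulrDl (mulrS _ k).
rewrite TX; apply/matrixP=> i j; rewrite !mxE.
by rewrite -mulr_natr pchar_Zp // mulr0 mul0r chi0.
Qed.

Lemma toPGL_Q7 : (toPGL (Sgl R * Tgl R ^+ 3) ^+ 7 = 1)%g.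
Proof.
rewrite -toPGLX; set Q : GL 6 R[i] := (_ * _)%g; set W := weil R 0 1 8.
(* Multiplying by [T ^ 3] adds 3 * 7 = 8 to the last parameter of [weil 0 1 0]. *)
have [c QE] : exists c, (Q : 'M_6) = c *: W.
  exists (- ((Num.sqrt 13)%:C)%C^-1); rewrite /Q /= Smx_weil Tmx_chi -scalemxAl.
  by rewrite !mulmxA !weil_diag /W; congr (_ *: weil _ _ _ _); apply/eqP.
move: Q QE => Q QE.
(* The powers 2, 3 and 4 of [W] up to scalars: [weilM] applies with [e] equal to 8, 10 and 7, and
   the parameters agree by evaluation in [F_13]. *)
have [c2 W2] : exists c2, W *m W = c2 *: weil R 2 9 10.
  by exists (gauss R 8); rewrite /W weilM.
have [c3 W3] : exists c3, weil R 2 9 10 *m W = c3 *: weil R 12 5 7.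
  by exists (gauss R 10); rewrite /W weilM.
have [c4 W4] : exists c4, weil R 12 5 7 *m W = c4 *: weil R 6 5 1.
  by exists (gauss R 7); rewrite /W weilM.
(* Since - 7 = 6 and - 12 = 1 in [F_13], the kernels of the third and fourth powers are inverse to
   each other up to a scalar. *)
have W7 : weil R 12 5 7 *m weil R 6 5 1 = (-13)%:M.
  rewrite -(@weil_scalar R 12 5 7) //; congr (_ *m weil _ _ _ _); exact/eqP.
have GM (A B : GL 6 R[i]) : GLmx (A * B)%g = (A : 'M_6) *m B by [].
have Q3 : GLmx (Q ^+ 3)%g = (c ^+ 3 * c2 * c3) *: weil R 12 5 7.
  rewrite !expgSr expg0 mul1g !GM QE -!(scalemxAl, scalemxAr) !scalerA W2.
  by rewrite -scalemxAl W3 !scalerA; congr (_ *: _); ring.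
rewrite (expgnDr Q 3 4) (expgSr Q 3).
apply: (@toPGL_scalar _ _ _ ((c ^+ 3 * c2 * c3) ^+ 2 * c * c4 * -13)).
rewrite GM (GM (Q ^+ 3)%g) Q3 QE -!(scalemxAl, scalemxAr) W4 -scalemxAr.
by rewrite W7 !scalerA scale_scalar_mx; congr (_%:M); ring.
Qed.

End Relations.

Local Open Scope classical_set_scope.
Local Open Scope group_scope.

(** * Generated subgroups and recovery of the generators *)

Section Generated.
Variables (gT : groupType) (A : set gT).
Implicit Types x y : gT.

Lemma generated_closed : group_closed [in generated A].
Proof.
split=> [|x y]; rewrite !inE.
  by move=> H [[]]; rewrite inE.
move=> hx hy H HA; have := HA.1.2 x y; rewrite !inE.
by apply; [exact: hx | exact: hy].
Qed.

Lemma generatedM x y : generated A x -> generated A y -> generated A (x * y).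
Proof.
by have := group_closedM generated_closed (x := x) (y := y); rewrite !inE.
Qed.

Lemma generatedV x : generated A x -> generated A x^-1.
Proof. by have := group_closedV generated_closed (x := x); rewrite !inE. Qed.

Lemma generatedX x n : generated A x -> generated A (x ^+ n).
Proof.
move=> Ax; elim: n => [|n IHn]; last by rewrite expgS; apply: generatedM.
by have [] := generated_closed; rewrite inE.
Qed.

End Generated.

Lemma generated_sub (gT : groupType) (A B : set gT) :
  A `<=` generated B -> generated A `<=` generated B.
Proof. by move=> AB; apply: smallest_sub => //; apply: generated_closed. Qed.

Lemma generated_QP2 (gT : groupType) (s t : gT) :
  let p := s * t^-1 * s in let q := s * t ^+ 3 in
  s ^+ 2 = 1 -> t ^+ 13 = 1 -> q ^+ 7 = 1 ->
  generated [set q * p ^+ 2; q ^+ 5 * p ^+ 2] = generated [set s; t].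
Proof.
move=> p q s2 t13 q7; have sV : s^-1 = s by rewrite -[LHS]mulg1 -s2 mulKg.
have pE : p = t^-1 ^ s by rewrite conjgE sV mulgA.
have pX n : p ^+ n = s * t ^- n * s.
  by rewrite pE -conjXg expVgn conjgE sV mulgA.
apply/seteqP; split; apply: generated_sub.
  set K := generated _.
  have Ks : K s by apply: sub_gen_smallest; left.
  have Kt : K t by apply: sub_gen_smallest; right.
  have Kp : K p by do 2?apply: generatedM => //; apply: generatedV.
  have Kq : K q by apply: generatedM => //; apply: generatedX.
  by move=> _ [|] ->; apply: generatedM => //; apply: generatedX.
set K := generated _.
have Kx : K (q * p ^+ 2) by apply: sub_gen_smallest; left.
have Ky : K (q ^+ 5 * p ^+ 2) by apply: sub_gen_smallest; right.
have Kq4 : K (q ^+ 4).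
  suff -> : q ^+ 4 = (q ^+ 5 * p ^+ 2) * (q * p ^+ 2)^-1.
    by apply: generatedM => //; apply: generatedV.
  by rewrite mulgKA (expgSr q 4) mulgK.
have Kq : K q.
  (* The exponent 4 * 2 = 8 is 1 modulo 7. *)
  suff -> : q = (q ^+ 4) ^+ 2 by apply: generatedX.
  by rewrite -expgnA (expgS q 7) q7 mulg1.
have Kp2 : K (p ^+ 2).
  by rewrite -(mulKg q (p ^+ 2)); apply: generatedM => //; apply: generatedV.
have Kp : K p.
  (* The exponent 2 * 7 = 14 is 1 modulo 13. *)
  suff -> : p = (p ^+ 2) ^+ 7 by apply: generatedX.
  by rewrite -expgnA (expgS p 13) pX t13 invg1 mulg1 -expg2 s2 mulg1.
have Ks : K s.
  suff -> : s = q^-1 * (p ^+ 3)^-1.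
    by apply: generatedM; apply: generatedV => //; apply: generatedX.
  rewrite pX (invgM (s / t ^+ 3) s) (invgM s (t ^- 3)) invgK sV.
  by rewrite (mulgA s) -/q mulKg.
move=> _ [|] -> //.
(* As [s] is an involution, conjugating [p] by it gives back [t^-1]. *)
suff -> : t = (s * p * s)^-1 by apply: generatedV; do 2?apply: generatedM.
by rewrite /p !mulgA -expg2 s2 mul1g -mulgA -expg2 s2 mulg1 invgK.
Qed.

Theorem theorem3p3 (R : realType) :
  let S : GL 6 R[i] := Sgl R in
  let T : GL 6 R[i] := Tgl R in
  let G : set (PGL 6 R[i]) := generated [set toPGL S; toPGL T] in
  let P := S * T^-1 * S in
  let Q := S * T ^+ 3 in
  let x3 := Q * P ^+ 2 in
  let y3 := Q ^+ 5 * P ^+ 2 in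
  generated [set toPGL x3; toPGL y3] = G.
Proof.
move=> S T G P Q x3 y3; have Q7 := toPGL_Q7 R.
rewrite toPGLM toPGLX in Q7.
(* The group argument is run in PGL, since [S ^ 2] is the scalar -1 and becomes trivial only
   there. *)
rewrite /G -(generated_QP2 _ _ _ (toPGL_S2 R) (toPGL_T13 R) Q7).
by rewrite /x3 /y3 /P /Q !(toPGLM, toPGLX, toPGLV).
Qed.
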